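(* Let $\mathbb{F}$ be a field and $\Gamma$ a finite group such that either $\mathrm{char}(\mathbb{F})=0$, or $\mathrm{char}(\mathbb{F})>0$ and $|\Gamma|$ and $\mathrm{char}(\mathbb{F})$ are coprime, and let $k\in\mathbb{N}$. There is a polynomial $p$ (depending only on $k$) such that for every finite set $X$ on which $\Gamma$ acts, every $\Gamma$-invariant unsatisfiable system $\mathcal{F}\subseteq\mathbb{F}[X]$ of degree at most $k$, and every $\Gamma$-symmetric EPC refutation $R$ of $\mathcal{F}$ of degree at most $k$, there is a $\Gamma$-symmetric $\vec y$-linear IPS refutation of $\mathcal{F}$ of size at most $p(|R|)$.
   Context: A system $\mathcal{F}=\{f_1,\dots,f_m\}\subseteq\mathbb{F}[X]$ has size $m+|X|$; a group acting on $X$ acts on polynomials by substitution and $\mathcal{F}$ is $\Gamma$-invariant if $\{\pi(f):f\in\mathcal{F}\}=\mathcal{F}$ for all $\pi\in\Gamma$. Extended polynomial calculus (EPC): an EPC refutation of $\mathcal{F}$ with extension axioms $\mathcal{E}=\{e_1,\dots,e_r\}$, where $e_i=x_{e_i}-f_{e_i}$ with fresh extension variables $x_{e_i}\notin X$ and $f_{e_i}\in\mathbb{F}[X\cup\{x_{e_1},\dots,x_{e_{i-1}}\}]$ (hierarchical order), is a sequence of polynomials ending with $1$, each of which is an element of $\mathcal{F}\cup\mathcal{E}$, or $z\cdot p$ for a variable $z$ and an earlier line $p$, or $ap+bq$ for $a,b\in\mathbb{F}$ and earlier lines $p,q$. Its degree is the maximum degree of a line; $|R|$ denotes the number of lines plus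 $|\mathcal{E}|$ plus $|\mathcal{F}|$. The action of $\Gamma$ naturally lifts to $\mathcal{E}$ if (1) $\mathcal{E}$ is partitioned into classes $C_1,\dots,C_s$ such that for $e\in C_i$, $f_e$ only contains extension variables from classes $C_j$ with $j<i$; (2) no two distinct extension variables $x_e\neq x_{e'}$ have $f_e=f_{e'}$; (3) $\pi(C_i)=C_i$ for all $i$ and $\pi\in\Gamma$, where $\pi(e)$ for $e\in C_1$ is the unique $e'\in\mathcal{E}$ with $f_{e'}=\pi(f_e)$ (via the action on $X$), and inductively for later classes using the already defined action on extension variables (required to exist). $R$ is $\Gamma$-symmetric if the action of $\Gamma$ naturally lifts to its set of extension axioms. An algebraic circuit over variables $Z$ and field $\mathbb{F}$ is a connected DAG with input gates labelled by elements of $Z\cup\mathbb{F}$ and internal gates labelled $+$ or $\times$ (arbitrary fan-in), single output, computing a polynomial; it is $\Gamma$-symmetric if each $\pi\in\Gamma$ extends to a DAG automorphism preserving internal labels and mapping each input gate labelled $z$ to one labelled $\pi(z)$ (constants fixed). IPS: with fresh $Y=\{y_1,\dots,y_m\}$, an IPS certificate is $C(\vec x,\vec y)\in\mathbb{F}[X\uplus Y]$ with $C(\vec x,\vec 0)=0$, $C(\vec x,f_1,\dots,f_m)=1$; an IPS refutation is a circuit over $X\uplus Y$ computing one; its size is $\max(\text{number of gates},|X|+|Y|)$; it is $\vec y$-linear if the certificate is $\sum_iy_ig_i(\vec x)$. $\Gamma$ acts on $Y$ by $\pi(y_i)=y_j$ where $\pi(f_i)=f_j$; a $\Gamma$-symmetric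 IPS refutation is one that is a $\Gamma$-symmetric circuit w.r.t. this action on $X\uplus Y$. *)

(* Defs.v *)
From HB Require Import structures.
From mathcomp Require Import all_boot all_order all_algebra all_fingroup.
From mathcomp Require Import mpoly.

Set Implicit Arguments.
Unset Strict Implicit.
Unset Printing Implicit Defensive.

Import GRing.Theory.
Local Open Scope ring_scope.

(* F[Z] for a finite set Z of variables: the variable z is the indeterminate
   of rank [enum_rank z]. *)
Definition mpol (F : fieldType) (Z : finType) := {mpoly F[#|Z|]}.

Section Polynomials.
Variable F : fieldType.

Definition mvar (Z : finType) (z : Z) : mpol F Z := 'X_(enum_rank z).

(* The total degree, with the convention that 0 has degree 0. *)
Definition mdegree (Z : finType) (p : mpol F Z) : nat := (msize p).-1.

Definition occurs (Z : finType) (z : Z) (p : mpol F Z) : bool :=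
  has (fun m : 'X_{1..#|Z|} => 0 < m (enum_rank z))%N (msupp p).

Definition msubst (Z Z' : finType) (h : Z -> mpol F Z') (p : mpol F Z) :
  mpol F Z' := p \mPo [tuple h (enum_val i) | i < #|Z|].

Definition mrename (Z Z' : finType) (h : Z -> Z') : mpol F Z -> mpol F Z' :=
  msubst (fun z => mvar (h z)).

Definition mevalv (Z : finType) (v : Z -> F) (p : mpol F Z) : F :=
  p.@[fun i => v (enum_val i)].

End Polynomials.

Section Systems.
Variables (F : fieldType) (X : finType) (m : nat).
Implicit Type Fs : m.-tuple (mpol F X).

Definition system_size Fs : nat := (m + #|X|)%N.

Definition system_degree Fs : nat := \max_(f <- Fs) mdegree f.

Definition unsatisfiable Fs : Prop :=
  ~ exists v : X -> F, forall f, f \in Fs -> mevalv v f = 0.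

(* Actions in the library are right actions, [to x (a * b) = to (to x a) b];
   everything below quantifies over all group elements, so the side does not
   matter. *)
Definition invariant_system (gT : finGroupType) (to : {action gT &-> X}) Fs :
  Prop :=
  forall pi : gT, [seq mrename (fun x => to x pi) f | f <- Fs] =i Fs.

End Systems.

Section EPC.
Variables (F : fieldType) (X : finType) (m : nat).
Implicit Type Fs : m.-tuple (mpol F X).

Section Lines.
Variables (r : nat) (ext : 'I_r -> mpol F (X + 'I_r)%type).

Definition ext_axiom (e : 'I_r) : mpol F (X + 'I_r)%type :=
  mvar F (inr e) - ext e.

Definition hierarchical : Prop :=
  forall i j : 'I_r, occurs (inr j) (ext i) -> (j < i)%N.

Definition epc_line Fs (prev : seq (mpol F (X + 'I_r)%type))
    (l : mpol F (X + 'I_r)%type) : Prop :=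
  [\/ exists2 f, f \in Fs & l = mrename inl f,
      exists e, l = ext_axiom e,
      exists z p, p \in prev /\ l = mvar F z * p
    | exists a b p q, [/\ p \in prev, q \in prev & l = a *: p + b *: q] ].

End Lines.

(* The extension variables are the [inr e], with e : 'I_epc_nb, and
   [epc_ext e] is the polynomial abbreviated by [inr e]. *)
Record epc_refutation Fs := EPCRefutation {
  epc_nb : nat;
  epc_ext : 'I_epc_nb -> mpol F (X + 'I_epc_nb)%type;
  epc_lines : seq (mpol F (X + 'I_epc_nb)%type);
  _ : hierarchical epc_ext;
  _ : forall i : nat, (i < size epc_lines)%N ->
        epc_line epc_ext Fs (take i epc_lines) (nth 0 epc_lines i);
  _ : last 0 epc_lines = 1
}.

Definition epc_degree Fs (R : epc_refutation Fs) : nat :=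
  \max_(l <- epc_lines R) mdegree l.

Definition epc_size Fs (R : epc_refutation Fs) : nat :=
  (size (epc_lines R) + epc_nb R + system_size Fs)%N.

Variables (gT : finGroupType) (to : {action gT &-> X}).

Definition ext_var_act (r : nat) (pi : gT) (h : 'I_r -> 'I_r)
    (z : (X + 'I_r)%type) : (X + 'I_r)%type :=
  match z with inl x => inl (to x pi) | inr e => inr (h e) end.

(* The third clause is the recursive definition of the action [act] on the
   extension axioms: by the first clause, [ext e] only involves extension
   variables of classes strictly below that of e, so the clause determines
   [act pi e] by induction on the class of e, uniquely by the second clause. *)
Definition naturally_lifts (r : nat) (ext : 'I_r -> mpol F (X + 'I_r)%type) :
  Prop :=
  exists (s : nat) (cls : 'I_r -> 'I_s) (act : gT -> 'I_r -> 'I_r),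
    [/\ forall e e', occurs (inr e') (ext e) -> (cls e' < cls e)%N,
        injective ext,
        forall pi e,
          ext (act pi e) = mrename (ext_var_act pi (act pi)) (ext e)
      & forall pi (i : 'I_s),
          act pi @: [set e | cls e == i] = [set e | cls e == i] ].

Definition epc_symmetric Fs (R : epc_refutation Fs) : Prop :=
  naturally_lifts (@epc_ext Fs R).

End EPC.

Section Circuits.
Variables (F : fieldType) (Z : finType).

Inductive gate_label := LVar of Z | LConst of F | LAdd | LMul.

Definition is_input (l : gate_label) : bool :=
  match l with LVar _ | LConst _ => true | LAdd | LMul => false end.

(* [wire g h] means that g is a child of (is fed into) h. *)
Record circuit := Circuit {
  gate : finType;
  wire : rel gate;
  label : gate -> gate_label;
  output : gate;
  _ : forall g h, wire g h -> ~~ connect wire h g;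
  _ : forall g h, connect [rel x y | wire x y || wire y x] g h;
  _ : forall g, is_input (label g) = ~~ [exists h, wire h g];
  _ : forall g, (g == output) = ~~ [exists h, wire g h]
}.

(* The valuation [v] of the gates is unique, by acyclicity. *)
Definition computes (C : circuit) (P : mpol F Z) : Prop :=
  exists2 v : gate C -> mpol F Z,
    forall g, v g = match label g with
                    | LVar z => mvar F z
                    | LConst c => c%:MP
                    | LAdd => \sum_(h | wire h g) v h
                    | LMul => \prod_(h | wire h g) v h
                    end
    & v (output C) = P.

Definition label_act (s : Z -> Z) (l : gate_label) : gate_label :=
  if l is LVar z then LVar (s z) else l.

Definition circuit_symmetric (G : Type) (act : G -> Z -> Z) (C : circuit) :
  Prop :=
  forall pi : G, exists phi : {perm gate C},
    (forall g h, wire (phi g) (phi h) = wire g h) /\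
    (forall g, label (phi g) = label_act (act pi) (label g)).

End Circuits.

Section IPS.
Variables (F : fieldType) (X : finType) (m : nat).
Implicit Type Fs : m.-tuple (mpol F X).

Definition ips_certificate Fs (P : mpol F (X + 'I_m)%type) : Prop :=
  msubst (fun z => match z with inl x => mvar F x | inr _ => 0 end) P = 0 /\
  msubst (fun z => match z with inl x => mvar F x | inr i => tnth Fs i end) P
    = 1.

Definition y_linear (P : mpol F (X + 'I_m)%type) : Prop :=
  exists g : 'I_m -> mpol F X,
    P = \sum_(i < m) mvar F (inr i) * mrename inl (g i).

(* The default value i in the case of y_i is never used when Fs is invariant,
   and the j picked is unique when the members of Fs are distinct. *)
Definition ips_act (gT : finGroupType) (to : {action gT &-> X}) Fs (pi : gT)
    (z : (X + 'I_m)%type) : (X + 'I_m)%type :=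
  match z with
  | inl x => inl (to x pi)
  | inr i => inr (odflt i
      [pick j | tnth Fs j == mrename (fun x => to x pi) (tnth Fs i)])
  end.

Definition ips_size (C : circuit F (X + 'I_m)%type) : nat :=
  maxn #|gate C| (#|X| + m).

End IPS.

(* Main.v *)
Require Import Defs.
From HB Require Import structures.
From mathcomp Require Import all_boot all_order all_algebra all_fingroup.
From mathcomp Require Import mpoly.

(* Write every line of degree at most k as a linear combination of words of
   bounded length in the original and extension variables; there are polynomially
   many words and the group permutes them.  Layer i of the circuit has a gate for
   each word u, whose value is a linear combination of the y's with coefficients
   in F[X], and which is such that the first i lines, expanded in words, are
   certified by layer i: replacing the y's by the axioms, the combination of the
   gates equals the line with the extension variables evaluated.  By the
   inference rules, layer i+1 can be obtained linearly from layer i, its products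
   with the variables, and the y's; since the order of the group is invertible,
   the linear map can be averaged over the group, and then the circuit is
   symmetric although the refutation itself is not.  Extension axioms evaluate to
   0 and need no y. *)

Set Implicit Arguments.
Unset Strict Implicit.
Unset Printing Implicit Defensive.

Import GRing.Theory.
Local Open Scope ring_scope.

(** * Substitution and renaming of variables *)

Section Substitution.
Variable F : fieldType.
Implicit Types Z : finType.

HB.instance Definition _ Z Z' (h : Z -> mpol F Z') :=
  GRing.RMorphism.copy (msubst h)
    (comp_mpoly [tuple h (enum_val i) | i < #|Z|]).
HB.instance Definition _ Z Z' (h : Z -> mpol F Z') :=
  GRing.Linear.copy (msubst h)
    (comp_mpoly [tuple h (enum_val i) | i < #|Z|]).

HB.instance Definition _ Z Z' (h : Z -> Z') :=
  GRing.RMorphism.copy (@mrename F Z Z' h) (msubst (fun z => mvar F (h z))).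
HB.instance Definition _ Z Z' (h : Z -> Z') :=
  GRing.Linear.copy (@mrename F Z Z' h) (msubst (fun z => mvar F (h z))).

Lemma msubst_var Z Z' (h : Z -> mpol F Z') z : msubst h (mvar F z) = h z.
Proof.
by rewrite /msubst /mvar comp_mpolyXU (nth_map (enum_rank z)) ?size_enum_ord //
  nth_ord_enum enum_rankK.
Qed.

Lemma mrename_var Z Z' (h : Z -> Z') z : mrename h (mvar F z) = mvar F (h z).
Proof. exact: msubst_var. Qed.

Lemma msubst_monomE Z Z' (h : Z -> mpol F Z') (p : mpol F Z) :
  msubst h p =
  \sum_(m <- msupp p) p@_m *: \prod_(z : Z) h z ^+ m (enum_rank z).
Proof.
rewrite /msubst comp_mpolyEX; apply: eq_bigr => m _; congr (_ *: _).
rewrite comp_mpolyX (reindex (@enum_rank Z)) /=; last first.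
  exact/onW_bij/enum_rank_bij.
by apply: eq_bigr => z _; rewrite tnth_mktuple enum_rankK.
Qed.

(** A variable that does not occur contributes only factors [h z ^+ 0]. The inductions along the
    classes of extension variables rest on this: two substitutions need only be compared on
    variables of lower class. *)
Lemma eq_msubst_in Z Z' (h h' : Z -> mpol F Z') (p : mpol F Z) :
  (forall z, occurs z p -> h z = h' z) -> msubst h p = msubst h' p.
Proof.
move=> eqh; rewrite !msubst_monomE; apply: eq_big_seq => m m_p.
congr (_ *: _); apply: eq_bigr => z _.
have [->|nz] := posnP (m (enum_rank z)); first by rewrite !expr0.
by rewrite eqh //; apply/hasP; exists m.
Qed.

Lemma eq_mrename_in Z Z' (h h' : Z -> Z') (p : mpol F Z) :
  (forall z, occurs z p -> h z = h' z) -> mrename h p = mrename h' p.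
Proof. by move=> eqh; apply: eq_msubst_in => z /eqh ->. Qed.

Lemma msubst_id Z (p : mpol F Z) : msubst (mvar F (Z := Z)) p = p.
Proof.
rewrite /msubst -[RHS]comp_mpoly_id; congr (comp_mpoly _ _).
by apply: eq_from_tnth => i; rewrite !tnth_mktuple /mvar enum_valK.
Qed.

Lemma msubst_msubst Z Z' Z'' (g : Z' -> mpol F Z'') (h : Z -> mpol F Z') p :
  msubst g (msubst h p) = msubst (fun z => msubst g (h z)) p.
Proof.
rewrite !(msubst_monomE _ p) linear_sum; apply: eq_bigr => m _ /=.
rewrite linearZ rmorph_prod /=; congr (_ *: _).
by apply: eq_bigr => z _; rewrite rmorphXn.
Qed.

Lemma msubst_mrename Z Z' Z'' (g : Z' -> mpol F Z'') (h : Z -> Z') p :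
  msubst g (mrename h p) = msubst (g \o h) p.
Proof.
by rewrite msubst_msubst; apply: eq_msubst_in => z _; rewrite msubst_var.
Qed.

Lemma mrename_mrename Z Z' Z'' (g : Z' -> Z'') (h : Z -> Z') (p : mpol F Z) :
  mrename g (mrename h p) = mrename (g \o h) p.
Proof. exact: msubst_mrename. Qed.

Lemma mrename_id Z (h : Z -> Z) (p : mpol F Z) : h =1 id -> mrename h p = p.
Proof.
by move=> hid; rewrite -[RHS]msubst_id; apply: eq_msubst_in => z _; rewrite hid.
Qed.

Lemma mdegree_le Z (p : mpol F Z) d :
  (mdegree p <= d)%N = (msize p <= d.+1)%N.
Proof. by rewrite /mdegree; case: (msize p). Qed.

(** Monomials go to monomials of the same degree, but when [h] is not injective they may cancel, so
    only an inequality holds. *)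
Lemma mdegree_mrename Z Z' (h : Z -> Z') (p : mpol F Z) :
  (mdegree (mrename h p) <= mdegree p)%N.
Proof.
have [->|p0] := eqVneq p 0; first by rewrite raddf0 /mdegree !msize0.
rewrite mdegree_le /mdegree prednK ?lt0n ?msize_poly_eq0 //.
rewrite {1}/mrename msubst_monomE.
apply: leq_trans (msize_sum _ _ _) _; apply/bigmax_leqP_seq => m m_p _.
apply: leq_trans (mmeasureZ_le _ _ _) _.
rewrite mprodXnE mmeasureX; apply: leq_trans (msize_mdeg_lt m_p).
rewrite ltnS /= mdeg_sum mdegE [leqRHS](reindex (@enum_rank Z)) /=; last first.
  exact/onW_bij/enum_rank_bij.
by apply: leq_sum => z _; rewrite mdegMn mdeg1 mul1n.
Qed.

End Substitution.

(** * Words: a spanning set of the polynomials of bounded degree *)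

Section Words.
Variables (F : fieldType) (V : finType) (d : nat).

(** [None] pads words shorter than [d]. Letters keep their positions, so several words may have the
    same value; only spanning matters, and a group permuting [V] permutes the words letter by
    letter. *)
Definition word := {ffun 'I_d -> option V}.

Definition word_val (u : word) : mpol F V :=
  \prod_(i < d) oapp (mvar F (Z := V)) 1 (u i).

Definition empty_word : word := [ffun=> None].

Lemma word_val_empty : word_val empty_word = 1.
Proof. by rewrite /word_val big1 // => i _; rewrite ffunE. Qed.

End Words.

Lemma word_of_monom (F : fieldType) (V : finType) (d : nat)
    (m : 'X_{1..#|V|}) :
  (mdeg m <= d)%N -> exists u : word V d, word_val F u = 'X_[m].
Proof.
elim: d m => [|d IH] m.
  rewrite leqn0 mdeg_eq0 => /eqP ->; exists (empty_word V 0).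
  by rewrite word_val_empty mpolyX0.
move=> m_d; have [->|m0] := eqVneq m 0%MM.
  by exists (empty_word V d.+1); rewrite word_val_empty mpolyX0.
have [i mi] : exists i, (0 < m i)%N.
  apply/existsP; apply: contraNT m0; rewrite negb_exists => /forallP mi0.
  by apply/eqP/mnmP => i; rewrite mnm0E; apply/eqP; rewrite -leqn0 leqNgt mi0.
have [u uE] : exists u : word V d, word_val F u = 'X_[m - U_(i)].
  apply: IH; move: m_d; rewrite -{1}(@submK _ U_(i) m) ?lep1mP -?lt0n //.
  by rewrite mdegD mdeg1 addn1.
exists [ffun j : 'I_d.+1 => if unlift ord0 j is Some j' then u j'
                            else Some (enum_val i)].
rewrite /word_val big_ord_recl ffunE unlift_none /= /mvar enum_valK.
under eq_bigr do rewrite ffunE liftK.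
by rewrite -/(word_val F u) uE -mpolyXD addmC submK // lep1mP -lt0n.
Qed.

Lemma word_span (F : fieldType) (V : finType) (d : nat) (p : mpol F V) :
  (mdegree p <= d)%N ->
  exists w : word V d -> F, p = \sum_u w u *: word_val F u.
Proof.
rewrite mdegree_le => p_d.
have span (s : seq 'X_{1..#|V|}) : {subset s <= msupp p} ->
    exists w : word V d -> F,
      \sum_(m <- s) p@_m *: 'X_[m] = \sum_u w u *: word_val F u.
  elim: s => [|m s IH] sP.
    by exists (fun=> 0); rewrite big_nil big1 // => u _; rewrite scale0r.
  have [w wE] := IH (fun m' ms => sP m' (mem_behead (s := m :: s) ms)).
  have m_d : (mdeg m <= d)%N.
    by have /msize_mdeg_lt/leq_trans/(_ p_d) := sP m (mem_head m s).
  have [u uE] := word_of_monom F m_d.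
  exists (fun u' => p@_m * (u' == u)%:R + w u').
  rewrite big_cons wE; under [RHS]eq_bigr do rewrite scalerDl -scalerA.
  rewrite big_split -scaler_sumr /=; congr (_ *: _ + _).
  rewrite (bigD1 u) //= eqxx scale1r uE big1 ?addr0 // => u' /negbTE ->.
  by rewrite scale0r.
by have [//|w wE] := span (msupp p); exists w; rewrite [LHS]mpolyE.
Qed.

(** * Making a well-formed circuit out of a ranked graph of gates *)

Section Pruning.
Variables (F : fieldType) (Z : finType).
Variables (G : finType) (wir : rel G) (lab : G -> gate_label F Z).
Variables (rk : G -> nat) (o : G) (v : G -> mpol F Z).
Hypothesis wir_rk : forall g h, wir g h -> (rk g < rk h)%N.
Hypothesis input_leaf : forall g, is_input (lab g) -> forall h, ~~ wir h g.
Hypothesis vE : forall g, v g = match lab g with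
                                | LVar z => mvar F z
                                | LConst c => c%:MP
                                | LAdd => \sum_(h | wir h g) v h
                                | LMul => \prod_(h | wir h g) v h
                                end.

(** Keeping the gates from which [o] can be reached makes [o] the only sink and connects everything
    through [o]. Children of a kept gate are kept, so no value changes. *)
Local Notation live := {g : G | connect wir g o}.

Definition live_wire : rel live := fun g h => wir (val g) (val h).

(** In a [circuit] every leaf is an input gate, so a childless sum or product turns into the
    constant that it computes. *)
Definition live_label (g : live) : gate_label F Z :=
  if [exists h, wir h (val g)] then lab (val g) else
  match lab (val g) with
  | LAdd => LConst Z 0
  | LMul => LConst Z 1
  | l => l
  end.

Definition live_output : live := exist _ o (connect0 wir o).

Lemma live_child (g : live) h : wir h (val g) -> connect wir h o.
Proof. by move=> whg; apply: connect_trans (connect1 whg) (valP g). Qed.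

Lemma connect_rank (T : finType) (e : rel T) (f : T -> nat) x y :
  (forall x y, e x y -> (f x < f y)%N) -> connect e x y -> (f x <= f y)%N.
Proof.
move=> ef /connectP [p ep ->] {y}.
elim: p x ep => //= y p IH x /andP[/ef/ltnW exy /IH]; exact: leq_trans.
Qed.

Lemma live_acyclic g h : live_wire g h -> ~~ connect live_wire h g.
Proof.
move=> wgh; apply/negP.
move=> /(connect_rank (f := fun g => rk (val g)) (fun x y => @wir_rk _ _)).
by rewrite leqNgt wir_rk.
Qed.

Lemma live_to_output (g : live) : connect live_wire g live_output.
Proof.
case: g => g g_o; have /connectP [p pP lastP] := g_o.
elim: p g g_o pP lastP => [|h p IH] g g_o /=.
  by move=> _ og; apply: eq_connect0; apply: val_inj.
case/andP=> wgh hp lastP.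
have h_o : connect wir h o by apply/connectP; exists p.
apply: connect_trans (IH h h_o hp lastP); exact: connect1.
Qed.

Lemma live_connected g h :
  connect [rel x y | live_wire x y || live_wire y x] g h.
Proof.
have sub : subrel (connect live_wire)
    (connect [rel x y | live_wire x y || live_wire y x]).
  by apply: connect_sub => x y wxy; apply: connect1; rewrite /= wxy.
apply: connect_trans (sub _ _ (live_to_output g)) _.
rewrite (sym_connect_sym (e := [rel x y | live_wire x y || live_wire y x])).
  exact: sub (live_to_output h).
by move=> x y /=; rewrite orbC.
Qed.

Lemma live_children (g : live) :
  [exists h, live_wire h g] = [exists h, wir h (val g)].
Proof.
apply/existsP/existsP => [[h whg]|[h whg]]; first by exists (val h).
by exists (exist _ h (live_child whg)); rewrite /live_wire.
Qed.

Lemma live_input g : is_input (live_label g) = ~~ [exists h, live_wire h g].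
Proof.
rewrite live_children /live_label; case: ifP => [/existsP [h whg]|_] /=.
  by apply/negbTE/negP => /input_leaf /(_ h); rewrite whg.
by case: (lab _).
Qed.

Lemma live_sink g : (g == live_output) = ~~ [exists h, live_wire g h].
Proof.
have [->|go] := eqVneq g live_output.
  (* A wire out of the output would close a cycle, since every live gate leads to the output. *)
  apply/esym/existsPn => h; apply: contraL (live_to_output h).
  exact: live_acyclic.
apply/esym/negbTE; rewrite negbK.
have /connectP [[|h p] /=] := live_to_output g.
  by move=> _ og; rewrite og eqxx in go.
by case/andP=> wgh _ _; apply/existsP; exists h.
Qed.

Definition pruned_circuit : circuit F Z :=
  Circuit live_acyclic live_connected live_input live_sink.

Lemma pruned_computes : computes pruned_circuit (v o).
Proof.
exists (fun g : live => v (val g)) => //= g.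
have insubE h : wir h (val g) -> omap val (insub h : option live) = Some h.
  by move=> /live_child ho; rewrite insubT.
rewrite /live_label; case: ifP => [_|/existsP nowire].
  rewrite vE; case: (lab _) => //; rewrite (reindex_omap _ _ insubE);
    by apply: eq_bigl => h; rewrite valK eqxx andbT.
rewrite vE; case: (lab _) => //.
  by rewrite big1 ?mpolyC0 // => h whg; case: nowire; exists h.
by rewrite big1 ?mpolyC1 // => h whg; case: nowire; exists h.
Qed.

Lemma pruned_card : (#|gate pruned_circuit| <= #|G|)%N.
Proof. by rewrite /= card_sig max_card. Qed.

(** A wire-preserving map that fixes [o] sends paths to [o] to paths to [o], so it restricts to the
    live gates; there injectivity gives a permutation, by finiteness. *)
Lemma pruned_symmetric (A : Type) (act : A -> Z -> Z) :
  (forall a, exists phi : G -> G,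
    [/\ injective phi, forall g h, wir (phi g) (phi h) = wir g h,
        forall g, lab (phi g) = label_act (act a) (lab g) & phi o = o]) ->
  circuit_symmetric act pruned_circuit.
Proof.
move=> sym a; have [phi [phi_inj phi_wir phi_lab phi_o]] := sym a.
have phi_live (g : live) : connect wir (phi (val g)) o.
  have /connectP [p pP lastE] := valP g.
  apply/connectP; exists (map phi p); last by rewrite last_map -lastE.
  by rewrite path_map (eq_path (e' := wir)).
pose psi (g : live) : live := exist _ (phi (val g)) (phi_live g).
have psi_inj : injective psi.
  by move=> g h /(congr1 val); move=> /= /phi_inj/val_inj.
exists (perm psi_inj); split=> [g h|g]; rewrite !permE.
  by rewrite /= /live_wire /= phi_wir.
rewrite /= /live_label /= phi_lab.
have -> : [exists h, wir h (phi (val g))] = [exists h, wir h (val g)].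
  apply/existsP/existsP => [[h whg]|[h whg]]; last first.
    by exists (phi h); rewrite phi_wir.
  by exists (invF phi_inj h); rewrite -phi_wir f_invF.
by case: ifP => // _; case: (lab _).
Qed.

End Pruning.

(** * Straight-line programs and their compilation into symmetric circuits *)

(* A node n of [N] is defined from the inputs [Z] and the nodes of smaller rank
   as the polynomial sum_j coef n j * prod_i fac n j i of degree at most d; the
   absent factors are represented by [None]. *)
Section Program.
Variables (F : fieldType) (Z N J : finType) (d : nat).
Variables (coef : N -> J -> F) (fac : N -> J -> 'I_d -> option (Z + N)%type).
Variable rk : N -> nat.
Hypothesis fac_rk : forall n j i n',
  fac n j i = Some (inr n') -> (rk n' < rk n)%N.

Definition node_val (Z' : finType) (h : Z -> mpol F Z') (v : N -> mpol F Z')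
    (x : (Z + N)%type) : mpol F Z' :=
  match x with inl z => h z | inr n => v n end.

Definition valuation (Z' : finType) (h : Z -> mpol F Z') (v : N -> mpol F Z') :=
  forall n, v n =
    \sum_j coef n j *: \prod_(i < d) oapp (node_val h v) 1 (fac n j i).

Lemma eq_oapp_node_val (Z' : finType) (h : Z -> mpol F Z') v v' n j i :
  (forall n', (rk n' < rk n)%N -> v n' = v' n') ->
  oapp (node_val h v) 1 (fac n j i) = oapp (node_val h v') 1 (fac n j i).
Proof.
by move=> vv'; case E: fac => [[//|n']|//] /=; apply: vv'; apply: fac_rk E.
Qed.

(** Iterating the defining equations from 0, the value of a node of rank less than [k] is stable
    after [k] rounds. *)
Lemma valuation_exists (Z' : finType) (h : Z -> mpol F Z') :
  exists v, valuation h v.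
Proof.
pose step (v : N -> mpol F Z') n :=
  \sum_j coef n j *: \prod_(i < d) oapp (node_val h v) 1 (fac n j i).
have stable k n : (rk n < k)%N ->
    iter k step (fun=> 0) n = iter k.+1 step (fun=> 0) n.
  elim: k n => // k IH n n_k; rewrite !(iterS k) iterS {1 3}/step.
  apply: eq_bigr => j _; congr (_ *: _); apply: eq_bigr => i _.
  apply: eq_oapp_node_val => n' n'_n; apply: IH.
  exact: leq_trans n'_n n_k.
exists (iter (\max_n rk n).+1 step (fun=> 0)) => n.
by apply: stable; rewrite ltnS leq_bigmax.
Qed.

(** Replacing the y's by the axioms in all values yields a valuation of the same program, so facts
    about programs apply before and after the replacement. *)
Lemma valuation_msubst (Z' Z'' : finType) (h : Z -> mpol F Z') v
    (g : Z' -> mpol F Z'') :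
  valuation h v -> valuation (msubst g \o h) (msubst g \o v).
Proof.
move=> vP n; rewrite /= vP linear_sum; apply: eq_bigr => j _.
rewrite linearZ rmorph_prod /=; congr (_ *: _); apply: eq_bigr => i _.
by case: fac => [[z|n']|] //=; rewrite rmorph1.
Qed.

Definition node_act (actZ : Z -> Z) (phi : N -> N) (x : (Z + N)%type) :
    (Z + N)%type :=
  match x with inl z => inl (actZ z) | inr n => inr (phi n) end.

(** Up to a permutation of the terms by [psi], both sides obey the same recursion; induction on the
    rank. *)
Lemma valuation_equivariant (Z' : finType) (h : Z -> mpol F Z') v
    (f : Z' -> Z') (actZ : Z -> Z) (phi : N -> N) (psi : J -> J) :
  valuation h v -> injective psi ->
  (forall n j, coef (phi n) (psi j) = coef n j) ->
  (forall n j i, fac (phi n) (psi j) i = omap (node_act actZ phi) (fac n j i)) ->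
  (forall z, h (actZ z) = mrename f (h z)) ->
  forall n, v (phi n) = mrename f (v n).
Proof.
move=> vP psi_inj coefE facE hE n.
have [k] := ubnP (rk n); elim: k n => // k IH n n_k.
rewrite vP [in RHS]vP linear_sum (reindex_inj psi_inj) /=.
apply: eq_bigr => j _; rewrite linearZ rmorph_prod /= coefE; congr (_ *: _).
apply: eq_bigr => i _; rewrite facE.
case E: fac => [[z|n']|] /=; rewrite ?rmorph1 //.
by apply: IH; apply: leq_trans (fac_rk E) _.
Qed.

(** Inputs and nodes, then for each term a product gate, a constant gate for its coefficient and a
    unary product gate for each factor. The unary gates are there because [wire] is a relation: a
    square could not be formed by wiring the same gate twice. *)
Definition gates : finType :=
  ((Z + N) + ((N * J) + ((N * J) + (N * J * 'I_d))))%type.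

Definition node_gate (x : (Z + N)%type) : gates := inl x.
Definition term_gate (t : N * J) : gates := inr (inl t).
Definition fac_gate (t : N * J * 'I_d) : gates := inr (inr (inr t)).

Definition prog_wire : rel gates := fun g h =>
  match g, h with
  | inl x, inr (inr (inr s)) => fac s.1.1 s.1.2 s.2 == Some x
  | inr (inr (inr s)), inr (inl t') => s.1 == t'
  | inr (inr (inl t)), inr (inl t') => t == t'
  | inr (inl t), inl (inr n) => t.1 == n
  | _, _ => false
  end.

Definition prog_label (g : gates) : gate_label F Z :=
  match g with
  | inl (inl z) => LVar F z
  | inl (inr _) => LAdd F Z
  | inr (inl _) => LMul F Z
  | inr (inr (inl t)) => LConst Z (coef t.1 t.2)
  | inr (inr (inr _)) => LMul F Z
  end.

(** The gates of a node take three consecutive levels: factors, terms, sum. The multiplier 4 keeps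
    them above the sums of all nodes of smaller rank. *)
Definition gate_rank (g : gates) : nat :=
  match g with
  | inl (inl _) => 0
  | inl (inr n) => 4 * rk n + 3
  | inr (inl t) => 4 * rk t.1 + 2
  | inr (inr (inl _)) => 0
  | inr (inr (inr s)) => 4 * rk s.1.1 + 1
  end%N.

Lemma prog_wire_rank g h : prog_wire g h -> (gate_rank g < gate_rank h)%N.
Proof.
case: g h => [[z|n]|[t|[t|[t i]]]] [[z'|n']|[t'|[t'|[t' i']]]] //=.
- by rewrite addn1.
- move=> /eqP/fac_rk n_t; apply: leq_trans (leq_addr 1 _).
  by rewrite -addnS -mulnSr leq_mul2l.
- by move/eqP->; rewrite ltn_add2l.
- by rewrite addn2.
- by move/eqP->; rewrite ltn_add2l.
Qed.

Lemma prog_input_leaf g : is_input (prog_label g) -> forall h, ~~ prog_wire h g.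
Proof.
by case: g => [[z|n]|[t|[t|[t i]]]] // _ [[z'|n']|[t'|[t'|[t' i']]]].
Qed.

Section Values.
Variable v : N -> mpol F Z.
Hypothesis vP : valuation (mvar F (Z := Z)) v.

Let nv := node_val (mvar F (Z := Z)) v.

Definition gate_val (g : gates) : mpol F Z :=
  match g with
  | inl x => nv x
  | inr (inl t) =>
      coef t.1 t.2 *: \prod_(i < d) oapp nv 1 (fac t.1 t.2 i)
  | inr (inr (inl t)) => (coef t.1 t.2)%:MP
  | inr (inr (inr s)) => oapp nv 1 (fac s.1.1 s.1.2 s.2)
  end.

Lemma big_option_pred1 (R : comPzRingType) (T : finType) (f : T -> R) o :
  \prod_(x | o == Some x) f x = oapp f 1 o.
Proof.
case: o => [x|] /=; last by rewrite big_pred0.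
by rewrite (eq_bigl (pred1 x)) ?big_pred1_eq // => y; apply: eq_sym.
Qed.

Lemma gate_valE g : gate_val g = match prog_label g with
                                 | LVar z => mvar F z
                                 | LConst c => c%:MP
                                 | LAdd => \sum_(h | prog_wire h g) gate_val h
                                 | LMul => \prod_(h | prog_wire h g) gate_val h
                                 end.
Proof.
case: g => [[z|n]|[t|[t|[t i]]]] //=.
- rewrite !big_sumType /= !big_pred0_eq !add0r !addr0 vP.
  transitivity (\sum_(n' | n' == n) \sum_j gate_val (term_gate (n', j))).
    by rewrite big_pred1_eq.
  rewrite pair_big_dep /=; apply: eq_big => [[n' j]|[n' j] _] //=.
  by rewrite andbT.
- rewrite !big_sumType /= !big_pred0_eq !mul1r big_pred1_eq mul_mpolyC.
  congr (_ *: _).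
  transitivity (\prod_(t' | t' == t) \prod_(i < d) gate_val (fac_gate (t', i))).
    by rewrite big_pred1_eq.
  rewrite pair_big_dep /=; apply: eq_big => [[t' i]|[t' i] _] //=.
  by rewrite andbT.
- by rewrite !big_sumType /= !big_pred0_eq !mulr1 -big_option_pred1 big_sumType.
Qed.

End Values.

(** A symmetry of the program acts on the gates by [phi] on nodes and [psi] on terms, and keeps the
    position of each factor. Pruning at the gate of [o] respects it because [phi] fixes [o]. *)
Lemma program_circuit (v : N -> mpol F Z) (o : N) :
  valuation (mvar F (Z := Z)) v ->
  exists C : circuit F Z,
    [/\ computes C (v o),
        (#|gate C| <= #|Z| + #|N| + (d + 2) * (#|N| * #|J|))%N
      & forall (A : Type) (act : A -> Z -> Z),
        (forall a, exists (phi : N -> N) (psi : J -> J),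
          [/\ injective (act a), injective phi, injective psi & phi o = o] /\
          [/\ forall n j, coef (phi n) (psi j) = coef n j &
              forall n j i, fac (phi n) (psi j) i =
                omap (node_act (act a) phi) (fac n j i)]) ->
        circuit_symmetric act C].
Proof.
move=> vP.
pose C := pruned_circuit (node_gate (inr o)) prog_wire_rank prog_input_leaf.
exists C; split.
- exact: (pruned_computes (node_gate (inr o)) _ _ (gate_valE vP)).
- apply: leq_trans (pruned_card _ _ _) _.
  rewrite !card_sum !card_prod card_ord leq_add2l mulnDl.
  by rewrite addnA addnn -mul2n addnC mulnC.
move=> A act sym; apply: pruned_symmetric => a.
have [phi [psi [[act_inj phi_inj psi_inj phi_o] [coefE facE]]]] := sym a.
pose ft (t : N * J) := (phi t.1, psi t.2).
have ft_inj : injective ft by move=> [n j] [n' j'] [/phi_inj -> /psi_inj ->].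
pose fx := node_act (act a) phi.
have fx_inj : injective fx.
  by move=> [z|n] [z'|n'] //= [] => [/act_inj|/phi_inj] ->.
pose f (g : gates) : gates :=
  match g with
  | inl x => inl (fx x)
  | inr (inl t) => inr (inl (ft t))
  | inr (inr (inl t)) => inr (inr (inl (ft t)))
  | inr (inr (inr s)) => inr (inr (inr (ft s.1, s.2)))
  end.
exists f; split.
- move=> [x|[t|[t|[t i]]]] [x'|[t'|[t'|[t' i']]]] //= [].
  + by move=> /fx_inj ->.
  + by move=> /phi_inj + /psi_inj; case: t t' => [? ?] [? ?] /= -> ->.
  + by move=> /phi_inj + /psi_inj; case: t t' => [? ?] [? ?] /= -> ->.
  + by move=> /phi_inj + /psi_inj + ->; case: t t' => [? ?] [? ?] /= -> ->.
- case=> [[z|n]|[t|[t|[t i]]]] [[z'|n']|[t'|[t'|[t' i']]]] //=;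
    rewrite ?(inj_eq phi_inj) ?(inj_eq ft_inj) // facE.
  + case: fac => [[z''|n'']|] //=.
    by rewrite !(inj_eq Some_inj) //= !(inj_eq inl_inj) (inj_eq act_inj).
  + case: fac => [[z''|n'']|] //=.
    by rewrite !(inj_eq Some_inj) //= !(inj_eq inr_inj) (inj_eq phi_inj).
- by case=> [[z|n]|[t|[t|[t i]]]] //=; rewrite coefE.
- by rewrite /f /= phi_o.
Qed.

End Program.

(** * Averaging a linear map over a group *)

Section Equivariant.
Variables (gT : finGroupType) (F : fieldType).

Definition is_act (T : Type) (a : gT -> T -> T) :=
  a 1%g =1 id /\ forall x y t, a (x * y)%g t = a y (a x t).

Lemma is_actK (T : Type) (a : gT -> T -> T) x :
  is_act a -> cancel (a x) (a x^-1)%g.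
Proof. by move=> [a1 aM] t; rewrite -aM mulgV a1. Qed.

Lemma is_actKV (T : Type) (a : gT -> T -> T) x :
  is_act a -> cancel (a x^-1)%g (a x).
Proof. by move=> [a1 aM] t; rewrite -aM mulVg a1. Qed.

Lemma reindex_is_act (T : finType) (a : gT -> T -> T) (E : nmodType)
    (f : T -> E) x :
  is_act a -> \sum_t f t = \sum_t f (a x t).
Proof.
move=> aP; rewrite (reindex (a x)) //=; apply: onW_bij.
by exists (a x^-1)%g; [apply: is_actK|apply: is_actKV].
Qed.

Hypothesis card_nz : #|gT|%:R != 0 :> F.
Variables (I J : finType) (aI : gT -> I -> I) (aJ : gT -> J -> J).
Hypotheses (aIP : is_act aI) (aJP : is_act aJ).
Variables (n : nat) (w : 'I_n -> I -> F) (q : 'I_n -> J -> F).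

(* The linear map sending the translates of each w_a to those of q_a need not
   exist, but T differs from such a map only by linear relations between the
   w's, which any pair of families Phi, Psi with Phi(q_a) = Psi(w_a) respects. *)
Lemma equivariant_section :
  exists T : I -> J -> F,
    (forall x i j, T (aI x i) (aJ x j) = T i j) /\
    forall (E : lmodType F) (aE : gT -> {linear E -> E})
        (Phi : J -> E) (Psi : I -> E),
      (forall x j, Phi (aJ x j) = aE x (Phi j)) ->
      (forall x i, Psi (aI x i) = aE x (Psi i)) ->
      (forall a, \sum_j q a j *: Phi j = \sum_i w a i *: Psi i) ->
      forall a, \sum_i w a i *: (\sum_j T i j *: Phi j) =
                \sum_i w a i *: Psi i.
Proof.
pose A := (gT * 'I_n)%type.
(* The rows of [R1] are all the translates of the [w a], those of [Q] the matching translates of the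
   [q a]. *)
pose R1 := \matrix_(b < #|{: A}|, i < #|I|)
  w (enum_val b).2 (aI (enum_val b).1^-1%g (enum_val i)).
pose Q := \matrix_(b < #|{: A}|, j < #|J|)
  q (enum_val b).2 (aJ (enum_val b).1^-1%g (enum_val j)).
(* By the pseudo-inverse, [M] sends a row of [R1] to some [B *m Q] such that [B *m R1] is that row;
   [B] may differ from the unit vector by a linear relation between the rows. *)
pose M := pinvmx R1 *m Q.
pose T0 i j := M (enum_rank i) (enum_rank j).
(* Averaging over the group makes the map invariant; this is where the order of the group is
   inverted. *)
exists (fun i j => #|gT|%:R^-1 * \sum_x T0 (aI x i) (aJ x j)); split.
  move=> x i j; congr (_ * _).
  rewrite [RHS](reindex_inj (mulgI x)) /=; apply: eq_bigr => y _.
  by rewrite aIP.2 aJP.2.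
move=> E aE Phi Psi PhiE PsiE qw a.
have QR (b : 'I_#|{: A}|) : \sum_j Q b j *: Phi (enum_val j) =
    \sum_i R1 b i *: Psi (enum_val i).
  set x := (enum_val b).1; set c := (enum_val b).2.
  transitivity (aE x (\sum_j q c j *: Phi j)).
    rewrite linear_sum [RHS](reindex_is_act _ x^-1 aJP) /=.
    rewrite [RHS](reindex (@enum_val J J)) /=; last first.
      exact/onW_bij/enum_val_bij.
    apply: eq_bigr => j _; rewrite mxE linearZ /=.
    by rewrite -PhiE is_actKV.
  rewrite qw linear_sum [LHS](reindex_is_act _ x^-1 aIP) /=.
  rewrite [LHS](reindex (@enum_val I I)) /=; last first.
    exact/onW_bij/enum_val_bij.
  apply: eq_bigr => i _; rewrite mxE linearZ /=.
  by rewrite -PsiE is_actKV.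
have T0E x : \sum_i w a (aI x^-1%g i) *: (\sum_j T0 i j *: Phi j) =
    \sum_i w a (aI x^-1%g i) *: Psi i.
  pose b := enum_rank ((x, a) : A).
  have R1b i : R1 b i = w a (aI x^-1%g (enum_val i)).
    by rewrite mxE enum_rankK.
  pose B := row b R1 *m pinvmx R1.
  have BR : B *m R1 = row b R1 by rewrite mulmxKpV ?row_sub.
  transitivity (\sum_j (B *m Q) 0 j *: Phi (enum_val j)).
    rewrite (reindex (@enum_val I I)) /=; last exact/onW_bij/enum_val_bij.
    under eq_bigr => i _.
      rewrite -R1b (reindex (@enum_val J J)) /=; last exact/onW_bij/enum_val_bij.
      rewrite scaler_sumr.
      under eq_bigr do rewrite /T0 !enum_valK scalerA.
      over.
    rewrite exchange_big /=; apply: eq_bigr => j _.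
    rewrite -scaler_suml -mulmxA -/M mxE; congr (_ *: _).
    by apply: eq_bigr => i _; rewrite [row b R1 _ _]mxE.
  under eq_bigr do rewrite mxE scaler_suml.
  rewrite exchange_big /=.
  under eq_bigr => c _.
    under eq_bigr do rewrite -scalerA.
    rewrite -scaler_sumr QR scaler_sumr.
    under eq_bigr do rewrite scalerA.
    over.
  rewrite exchange_big /= [RHS](reindex (@enum_val I I)) /=; last first.
    exact/onW_bij/enum_val_bij.
  apply: eq_bigr => i _; rewrite -scaler_suml -R1b; congr (_ *: _).
  by have /rowP/(_ i) := BR; rewrite !mxE.
transitivity (#|gT|%:R^-1 *: \sum_(x : gT)
    \sum_i w a i *: (\sum_j T0 (aI x i) (aJ x j) *: Phi j)).
  rewrite exchange_big scaler_sumr /=; apply: eq_bigr => i _.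
  rewrite -scaler_sumr !scalerA mulrC -!scalerA; congr (_ *: _).
  rewrite exchange_big scaler_sumr /=; apply: eq_bigr => j _.
  by rewrite -scalerA scaler_suml.
rewrite (eq_bigr (fun=> \sum_i w a i *: Psi i)) => [|x _].
  by rewrite sumr_const -scaler_nat scalerA mulVf ?scale1r.
(* The summand for [x] is [T0E x] moved by [x^-1], so all summands of the average have the same
   value. *)
transitivity (aE x^-1%g (\sum_i w a (aI x^-1%g i) *: Psi i)).
  rewrite -T0E linear_sum [LHS](reindex_is_act _ x^-1 aIP) /=.
  apply: eq_bigr => i _; rewrite linearZ /= is_actKV //; congr (_ *: _).
  rewrite linear_sum [LHS](reindex_is_act _ x^-1 aJP) /=.
  by apply: eq_bigr => j _; rewrite linearZ /= is_actKV // PhiE.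
rewrite linear_sum [RHS](reindex_is_act _ x^-1 aIP) /=.
by apply: eq_bigr => i _; rewrite linearZ /= PsiE.
Qed.

End Equivariant.

(** * The action on words *)

Section WordAction.
Variables (F : fieldType) (gT : finGroupType) (V : finType) (d : nat).
Variable a : gT -> V -> V.

Definition word_act (x : gT) (u : word V d) : word V d :=
  [ffun i => omap (a x) (u i)].

Lemma word_act_is_act : is_act a -> is_act word_act.
Proof.
move=> [a1 aM]; split=> [u|x y u]; apply/ffunP=> i; rewrite !ffunE.
  by case: (u i) => //= z; rewrite a1.
by case: (u i) => //= z; rewrite aM.
Qed.

Lemma word_act_empty x : word_act x (empty_word V d) = empty_word V d.
Proof. by apply/ffunP=> i; rewrite !ffunE. Qed.

Lemma word_val_act x u :
  word_val F (word_act x u) = mrename (a x) (word_val F u).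
Proof.
rewrite rmorph_prod; apply: eq_bigr => i _; rewrite ffunE.
by case: (u i) => [z|] /=; rewrite ?rmorph1 ?mrename_var.
Qed.

End WordAction.

(** * The lifted action on extension variables *)

Section NaturalLift.
Variables (F : fieldType) (gT : finGroupType) (X : finType).
Variables (to : {action gT &-> X}) (r : nat).
Variables (ext : 'I_r -> mpol F (X + 'I_r)%type).
Variables (s : nat) (cls : 'I_r -> 'I_s) (act : gT -> 'I_r -> 'I_r).
Hypothesis ext_cls :
  forall e e', occurs (inr e') (ext e) -> (cls e' < cls e)%N.
Hypothesis ext_inj : injective ext.
Hypothesis ext_act : forall x e,
  ext (act x e) = mrename (ext_var_act to x (act x)) (ext e).
Hypothesis act_cls : forall x (i : 'I_s),
  act x @: [set e | cls e == i] = [set e | cls e == i].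

Local Notation var_act := (fun x => ext_var_act to x (act x)).

Lemma cls_act x e : cls (act x e) = cls e.
Proof.
have : act x e \in act x @: [set e' | cls e' == cls e].
  by apply: imset_f; rewrite inE.
by rewrite act_cls inE => /eqP.
Qed.

(** Each class is mapped onto itself, so [act x] is surjective on a finite set. *)
Lemma lift_act_inj x : injective (act x).
Proof.
have /fin_all_exists [g gK] : forall e, exists e', act x e' = e.
  move=> e; have : e \in act x @: [set e' | cls e' == cls e].
    by rewrite act_cls inE.
  by case/imsetP=> e' _ ->; exists e'.
have /injF_bij [h hK Kh] := can_inj gK.
by apply: (can_inj (g := g)) => e; rewrite -{1}(Kh e) gK Kh.
Qed.

(** As [ext] is injective, it suffices to compare the defining polynomials; these involve only
    extension variables of lower class, where the induction hypothesis applies. *)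
Lemma lift_actM x y e : act (x * y)%g e = act y (act x e).
Proof.
have [n] := ubnP (cls e); elim: n e => // n IH e e_n.
apply: ext_inj; rewrite !ext_act mrename_mrename.
apply: eq_mrename_in => -[z|e'] /= e'_e; first by rewrite actM.
by congr inr; apply: IH; apply: leq_trans (ext_cls e'_e) _.
Qed.

Lemma lift_act1 e : act 1%g e = e.
Proof. by apply: (@lift_act_inj 1%g); rewrite -lift_actM mulg1. Qed.

Lemma var_act_is_act : is_act var_act.
Proof.
by split=> [[z|e]|x y [z|e]] /=; rewrite ?act1 ?actM ?lift_act1 ?lift_actM.
Qed.

Variable d : nat.

(* Extension variables with axioms of large degree are never used in a
   refutation of small degree; they are replaced by 0. *)
Definition low_ext (e : 'I_r) : mpol F (X + 'I_r)%type :=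
  if (mdegree (ext e) <= d)%N then ext e else 0.

Lemma low_ext_cls e e' : occurs (inr e') (low_ext e) -> (cls e' < cls e)%N.
Proof.
rewrite /low_ext; case: ifP => _; first exact: ext_cls.
by rewrite /occurs msupp0.
Qed.

Lemma mdegree_low_ext e : (mdegree (low_ext e) <= d)%N.
Proof. by rewrite /low_ext; case: ifP => // _; rewrite /mdegree msize0. Qed.

Lemma low_ext_act x e : low_ext (act x e) = mrename (var_act x) (low_ext e).
Proof.
(* Renaming by [x] can be undone by [x^-1], hence preserves the degree, and both sides fall into the
   same case. *)
have -> : low_ext (act x e) =
    if (mdegree (ext e) <= d)%N then ext (act x e) else 0.
  rewrite /low_ext; congr (if (_ <= d)%N then _ else _); rewrite ext_act.
  apply/eqP; rewrite eqn_leq mdegree_mrename /=.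
  rewrite -{1}[ext e](@mrename_id _ _ (var_act x^-1%g \o var_act x)).
    by rewrite -mrename_mrename mdegree_mrename.
  exact: (is_actK (a := var_act) x var_act_is_act).
by rewrite /low_ext; case: ifP => _; rewrite ?ext_act // raddf0.
Qed.

Local Notation W := (word (X + 'I_r)%type d).

Definition low_word (e : 'I_r) (u : W) : bool :=
  [forall i, if u i is Some (inr e') then (cls e' < cls e)%N else true].

Lemma low_word_act x e u :
  low_word (act x e) (word_act var_act x u) = low_word e u.
Proof.
apply: eq_forallb => i; rewrite ffunE.
by case: (u i) => [[z|e']|] //=; rewrite !cls_act.
Qed.

(** Invariant coefficients make the evaluation of the extension variables symmetric; the restriction
    to low words keeps it acyclic. *)
Lemma low_ext_words : #|gT|%:R != 0 :> F ->
  exists c : 'I_r -> W -> F,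
    [/\ forall x e u, c (act x e) (word_act var_act x u) = c e u,
        forall e u, ~~ low_word e u -> c e u = 0
      & forall e, low_ext e = \sum_u c e u *: word_val F u].
Proof.
move=> card_nz.
have /fin_all_exists [q qE] e := word_span (mdegree_low_ext e).
have act_is_act : is_act act by split; [apply: lift_act1|apply: lift_actM].
(* With the unit vectors for [w], the averaged map expands each [low_ext e] itself, rather than only
   combinations of them. *)
have [T [Tact TE]] := equivariant_section card_nz act_is_act
  (word_act_is_act d var_act_is_act) (fun e e' => (e' == e)%:R) q.
have {TE}TE e : low_ext e = \sum_u T e u *: word_val F u.
  have delta e1 (f : 'I_r -> mpol F (X + 'I_r)%type) :
      \sum_e2 (e2 == e1)%:R *: f e2 = f e1.
    rewrite (bigD1 e1) //= eqxx scale1r big1 ?addr0 // => e2 /negbTE ->.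
    by rewrite scale0r.
  rewrite -(delta e low_ext) -(TE _ (fun x => mrename (F := F) (var_act x))
    (word_val F (d := d)) low_ext) ?delta //.
  - by move=> x u; rewrite word_val_act.
  - by move=> x e'; rewrite low_ext_act.
  - by move=> e'; rewrite delta -qE.
exists (fun e u => if low_word e u then T e u else 0); split.
- by move=> x e u; rewrite low_word_act Tact.
- by move=> e u /negbTE ->.
move=> e.
(* Averaging may bring in words that are not low. Setting the extension variables of class at least
   [cls e] to 0 kills these words and fixes [low_ext e]. *)
pose h (z : (X + 'I_r)%type) : mpol F (X + 'I_r)%type :=
  if z is inr e' then (if (cls e' < cls e)%N then mvar F z else 0)
  else mvar F z.
have -> : low_ext e = msubst h (low_ext e).
  rewrite -{1}[low_ext e]msubst_id; apply: eq_msubst_in => -[z|e'] //=.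
  by move/low_ext_cls => ->.
rewrite {1}TE linear_sum; apply: eq_bigr => u _.
rewrite linearZ /= rmorph_prod /=.
case: ifP => [/forallP low|/negbT/forallPn [i]].
  congr (_ *: _); apply: eq_bigr => i _; have := low i.
  by case: (u i) => [[z|e']|] /=; rewrite ?msubst_var ?rmorph1 //= => ->.
case E: (u i) => [[//|e']|//] e'_e.
rewrite scale0r (bigD1 i) //= E /= msubst_var /= (negbTE e'_e) mul0r.
by rewrite scaler0.
Qed.

End NaturalLift.

(** * The action on the axioms of the system *)

Section AxiomAction.
Variables (F : fieldType) (gT : finGroupType) (X : finType).
Variables (to : {action gT &-> X}) (m : nat) (Fs : m.-tuple (mpol F X)).
Hypotheses (Fs_uniq : uniq Fs) (Fs_inv : invariant_system to Fs).

(** The action of [ips_act] on the y's, as a map of indices. Invariance of [Fs] makes the search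
    succeed, and [uniq Fs] makes its result unique. *)
Definition axiom_act (x : gT) (i : 'I_m) : 'I_m :=
  odflt i [pick j | tnth Fs j == mrename (to^~ x) (tnth Fs i)].

Lemma tnth_axiom_act x i :
  tnth Fs (axiom_act x i) = mrename (to^~ x) (tnth Fs i).
Proof.
rewrite /axiom_act; case: pickP => [j /eqP //|none] /=.
have : mrename (to^~ x) (tnth Fs i) \in Fs.
  by rewrite -(Fs_inv x); apply: map_f; apply: mem_tnth.
by case/tnthP=> j /esym/eqP; rewrite none.
Qed.

Lemma tnth_uniq_inj : injective (tnth Fs).
Proof. exact/tuple_uniqP. Qed.

Lemma axiom_act_is_act : is_act axiom_act.
Proof.
split=> [i|x y i]; apply: tnth_uniq_inj; rewrite !tnth_axiom_act.
  by apply: mrename_id => z; apply: act1.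
by rewrite mrename_mrename; apply: eq_mrename_in => z _ /=; rewrite actM.
Qed.

End AxiomAction.

(** * From one layer of certificates to the next *)

Section Layers.
Variables (F : fieldType) (gT : finGroupType) (X : finType).
Variables (to : {action gT &-> X}) (m : nat) (Fs : m.-tuple (mpol F X)).
Hypotheses (Fs_uniq : uniq Fs) (Fs_inv : invariant_system to Fs).
Hypothesis card_nz : #|gT|%:R != 0 :> F.
Variables (r : nat) (ext : 'I_r -> mpol F (X + 'I_r)%type).
Variable lines : seq (mpol F (X + 'I_r)%type).
Hypothesis linesP : forall i : nat, (i < size lines)%N ->
  epc_line ext Fs (take i lines) (nth 0 lines i).

Local Notation V := (X + 'I_r)%type.

Variable var_act : gT -> V -> V.
Hypothesis var_actP : is_act var_act.
Variable d : nat.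

Local Notation W := (word V d).

Variable w : nat -> W -> F.
Hypothesis wE : forall j, nth 0 lines j = \sum_u w j u *: word_val F u.

(** The terms that a new layer may combine: a gate of the previous layer, a variable times such a
    gate, or one of the y's. *)
Definition step : finType := (W + ((V * W) + 'I_m))%type.

Definition step_act (x : gT) (j : step) : step :=
  match j with
  | inl u => inl (word_act var_act x u)
  | inr (inl zu) => inr (inl (var_act x zu.1, word_act var_act x zu.2))
  | inr (inr i) => inr (inr (axiom_act to Fs x i))
  end.

Lemma step_act_is_act : is_act step_act.
Proof.
have [w1 wM] := word_act_is_act d var_actP.
have [f1 fM] := axiom_act_is_act Fs_uniq Fs_inv.
have [v1 vM] := var_actP.
split=> [[u|[[z u]|i]]|x y [u|[[z u]|i]]] /=.
- by rewrite w1.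
- by rewrite w1 v1.
- by rewrite f1.
- by rewrite wM.
- by rewrite wM vM.
- by rewrite fM.
Qed.

Definition step_val (Z : finType) (y : 'I_m -> mpol F Z) (th : V -> mpol F Z)
    (C : W -> mpol F Z) (j : step) : mpol F Z :=
  match j with
  | inl u => C u
  | inr (inl zu) => C zu.2 * th zu.1
  | inr (inr i) => y i
  end.

(* th is the evaluation of the variables as polynomials in X, and C u the value
   of the certificate of the word u once the y's are replaced by Fs. *)
Definition good_eval (th : V -> mpol F X) :=
  (forall z, th (inl z) = mvar F z) /\
  forall e, ext_axiom ext e \in lines -> msubst th (ext e) = th (inr e).

Definition certifies (th : V -> mpol F X) (C : W -> mpol F X) (j : nat) :=
  \sum_u w j u *: C u = msubst th (nth 0 lines j).

Lemma sum_step (E : nmodType) (f : step -> E) :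
  \sum_j f j = \sum_u f (inl u) +
    (\sum_zu f (inr (inl zu)) + \sum_i f (inr (inr i))).
Proof. by rewrite !big_sumType. Qed.

(** The coefficients [q] come from the inference rule and the [w j] alone and serve every [th] and
    [C], so the circuit can be laid out before its values are known. *)
Lemma line_step (i : nat) : (i < size lines)%N ->
  exists q : step -> F, forall th C,
    good_eval th -> (forall j, (j < i)%N -> certifies th C j) ->
    \sum_j q j *: step_val (tnth Fs) th C j = msubst th (nth 0 lines i).
Proof.
move=> i_lines.
have prevP p : p \in take i lines -> exists2 j, (j < i)%N & p = nth 0 lines j.
  move=> p_i; have idx : (index p (take i lines) < i)%N.
    by move: p_i; rewrite -index_mem size_take i_lines.
  by exists (index p (take i lines)); rewrite // -(nth_take 0 idx) nth_index.
case: (linesP i_lines).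
- case=> f /tnthP [k ->] ->.
  exists (fun j => (j == inr (inr k))%:R) => th C [thX _] _.
  rewrite (bigD1 (inr (inr k))) //= eqxx scale1r big1 ?addr0; last first.
    by move=> j /negbTE ->; rewrite scale0r.
  by rewrite msubst_mrename -[LHS]msubst_id; apply: eq_msubst_in => z _ /=.
- case=> e lE; exists (fun=> 0) => th C [_ thE] _.
  rewrite big1 => [|j _]; last by rewrite scale0r.
  rewrite lE raddfB /= msubst_var thE ?subrr // -lE; exact: mem_nth.
- case=> z [p [/prevP [j j_i ->] ->]].
  exists (fun t => if t is inr (inl zu) then (zu.1 == z)%:R * w j zu.2 else 0).
  move=> th C _ /(_ j j_i) Cj; rewrite sum_step /= big1 ?add0r; last first.
    by move=> u _; rewrite scale0r.
  rewrite [X in _ + X]big1 ?addr0; last by move=> k _; rewrite scale0r.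
  rewrite rmorphM /= msubst_var -Cj mulrC mulr_suml.
  rewrite -(pair_bigA _ (fun z' u =>
    ((z' == z)%:R * w j u) *: (C u * th z'))) /=.
  rewrite (bigD1 z) //= [X in _ + X]big1 ?addr0 => [|z' /negbTE ->].
    by apply: eq_bigr => u _; rewrite eqxx mul1r scalerAl.
  by rewrite big1 // => u _; rewrite mul0r scale0r.
- case=> a [b [p [p' [/prevP [j j_i ->] /prevP [j' j'_i ->] ->]]]].
  exists (fun t => if t is inl u then a * w j u + b * w j' u else 0).
  move=> th C _ CP; rewrite sum_step /= [X in _ + (X + _)]big1; last first.
    by move=> u _; rewrite scale0r.
  rewrite [X in _ + (_ + X)]big1 ?addr0; last by move=> k _; rewrite scale0r.
  rewrite raddfD /= !linearZ /= -!CP // !scaler_sumr -big_split.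
  by apply: eq_bigr => u _; rewrite scalerDl !scalerA.
Qed.

(** The new layer certifies line [i] and all earlier lines anew: [line_step] gives coefficients for
    each of them, and [equivariant_section] merges these into one map on words. Only the
    combinations given by the lines are controlled; a single gate [C u] need not be the evaluation
    of [u]. *)
Lemma layer_exists (i : nat) : (i < size lines)%N ->
  exists T : W -> step -> F,
    (forall x u j, T (word_act var_act x u) (step_act x j) = T u j) /\
    forall th C,
      (forall x z, th (var_act x z) = mrename (to^~ x) (th z)) ->
      (forall x u, C (word_act var_act x u) = mrename (to^~ x) (C u)) ->
      good_eval th -> (forall j, (j < i)%N -> certifies th C j) ->
      forall j, (j <= i)%N ->
        certifies th (fun u => \sum_j T u j *: step_val (tnth Fs) th C j) j.
Proof.
move=> i_lines.
have /fin_all_exists [q qE] (j : 'I_i.+1) : exists q : step -> F, forall th C,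
    good_eval th -> (forall j, (j < i)%N -> certifies th C j) ->
    \sum_t q t *: step_val (tnth Fs) th C t = msubst th (nth 0 lines j).
  have j_i : (j <= i)%N by rewrite -ltnS.
  have [q qE] := line_step (leq_ltn_trans j_i i_lines).
  exists q => th C thP CP; apply: qE => // j' j'_j.
  by apply: CP; apply: leq_trans j'_j j_i.
have [T [Tact TE]] := equivariant_section card_nz (word_act_is_act d var_actP)
  step_act_is_act (fun j : 'I_i.+1 => w j) q.
exists T; split=> // th C th_act C_act thP CP j j_i.
have wth (j' : nat) : \sum_u w j' u *: msubst th (word_val F u) =
    msubst th (nth 0 lines j').
  by rewrite wE linear_sum; apply: eq_bigr => u _; rewrite linearZ.
(* In [equivariant_section], [Phi] is now the value of the terms and [Psi] the evaluation of words
   under [th]. *)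
rewrite /certifies -wth.
apply: (TE _ (fun x => mrename (F := F) (to^~ x)) (step_val (tnth Fs) th C)
  (fun u => msubst th (word_val F u)) _ _ _ (Ordinal (j_i : (j < i.+1)%N))).
- move=> x [u|[[z u]|k]] /=; first exact: C_act.
    by rewrite rmorphM /= C_act th_act.
  exact: tnth_axiom_act.
- move=> x u; rewrite word_val_act msubst_mrename.
  rewrite [RHS]msubst_msubst; apply: eq_msubst_in => z _ /=.
  by rewrite th_act.
- by move=> j'; rewrite qE // wth.
Qed.

End Layers.

(** * Linearity in the y's *)

Section YLinear.
Variables (F : fieldType) (X : finType) (m : nat).
Implicit Type P : mpol F (X + 'I_m)%type.

Lemma y_linear0 : @y_linear F X m 0.
Proof.
by exists (fun=> 0); rewrite big1 // => i _; rewrite raddf0 mulr0.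
Qed.

Lemma y_linearD P Q : y_linear P -> y_linear Q -> y_linear (P + Q).
Proof.
move=> [g ->] [h ->]; exists (fun i => g i + h i); rewrite -big_split.
by apply: eq_bigr => i _; rewrite raddfD mulrDr.
Qed.

Lemma y_linearM P (q : mpol F X) : y_linear P -> y_linear (P * mrename inl q).
Proof.
move=> [g ->]; exists (fun i => g i * q); rewrite mulr_suml.
by apply: eq_bigr => i _; rewrite rmorphM mulrA.
Qed.

Lemma y_linearZ a P : y_linear P -> y_linear (a *: P).
Proof.
move=> [g ->]; exists (fun i => a *: g i); rewrite scaler_sumr.
by apply: eq_bigr => i _; rewrite linearZ /= scalerAr.
Qed.

Lemma y_linear_var i : y_linear (mvar F (inr i : (X + 'I_m)%type)).
Proof.
exists (fun j => (j == i)%:R); rewrite (bigD1 i) //= eqxx rmorph1 mulr1.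
by rewrite big1 ?addr0 // => j /negbTE ->; rewrite raddf0 mulr0.
Qed.

Lemma y_linear_at0 P (h : (X + 'I_m)%type -> mpol F X) :
  (forall i, h (inr i) = 0) -> y_linear P -> msubst h P = 0.
Proof.
move=> h0 [g ->]; rewrite linear_sum big1 // => i _.
by rewrite rmorphM /= msubst_var h0 mul0r.
Qed.

End YLinear.

(** * The program of a refutation *)

Section RefutationProgram.
Variables (F : fieldType) (gT : finGroupType) (X : finType).
Variables (to : {action gT &-> X}) (m : nat) (Fs : m.-tuple (mpol F X)).
Variables (r s : nat) (cls : 'I_r -> 'I_s) (act : gT -> 'I_r -> 'I_r).
Variables (d L : nat).

Local Notation V := (X + 'I_r)%type.
Local Notation W := (word V d.+2).
Local Notation step := (step X m r d.+2).
Local Notation var_act := (fun x => ext_var_act to x (act x)).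

Variables (c : 'I_r -> W -> F) (T : nat -> W -> step -> F).

(* The node [inl e] computes the value of the extension variable e, and
   [inr (i, u)] the certificate of the word u in layer i. *)
Definition node : finType := ('I_r + 'I_L.+1 * W)%type.

Definition var_node (z : V) : ((X + 'I_m) + node)%type :=
  match z with inl x => inl (inl x) | inr e => inr (inl e) end.

(** Layer 0 is identically 0: it has no line to certify. *)
Definition node_coef (n : node) (j : step) : F :=
  match n with
  | inl e => if j is inl u then c e u else 0
  | inr iu => if (iu.1 : nat) is i.+1 then T i iu.2 j else 0
  end.

(** Layer terms put a previous gate or a y at position 0 and a variable at position 1, for which the
    length [d.+2] leaves room; all other positions count as 1. *)
Definition node_fac (n : node) (j : step) (k : 'I_d.+2) :
    option ((X + 'I_m) + node)%type :=
  match n with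
  | inl e => if j is inl u then
               if low_word cls e u then omap var_node (u k) else None
             else None
  | inr iu => if (iu.1 : nat) is i.+1 then
      let prev u := Some (inr (inr (inord i, u))) in
      match j, (k : nat) with
      | inl u, 0 => prev u
      | inr (inl zu), 0 => prev zu.2
      | inr (inl zu), 1 => Some (var_node zu.1)
      | inr (inr a), 0 => Some (inl (inr a))
      | _, _ => None
      end else None
  end%N.

(** Classes are below [s], so every extension variable precedes every layer. *)
Definition node_rank (n : node) : nat :=
  match n with inl e => cls e | inr iu => s + iu.1 end%N.

Lemma node_fac_rank n j k n' :
  node_fac n j k = Some (inr n') -> (node_rank n' < node_rank n)%N.
Proof.
case: n => [e|[i u]] /=.
  case: j => [u|//]; case: ifP => // /forallP/(_ k).
  by case: (u k) => [[x|e']|] //= e'_e [<-].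
case: i => -[//|i] /= i_L.
have i_i : (s + (inord i : 'I_L.+1) < s + i.+1)%N.
  by rewrite inordK ?ltn_add2l // ltnW.
case: j => [u'|[[z u']|a]]; case: k => -[|[|k]] //= _.
- by case=> <-.
- by case=> <-.
case: z => [x|e] //= [<-] /=.
by apply: leq_trans (ltn_ord (cls e)) _; apply: leq_addr.
Qed.

Definition program_act (x : gT) (n : node) : node :=
  match n with
  | inl e => inl (act x e)
  | inr iu => inr (iu.1, word_act var_act x iu.2)
  end.

Lemma var_node_act x z :
  var_node (var_act x z) =
  node_act (ips_act to Fs x) (program_act x) (var_node z).
Proof. by case: z. Qed.

Section Symmetry.
Hypothesis act_cls : forall x (i : 'I_s),
  act x @: [set e | cls e == i] = [set e | cls e == i].
Hypothesis c_act : forall x e u, c (act x e) (word_act var_act x u) = c e u.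
Hypothesis T_act : forall i x u j,
  T i (word_act var_act x u) (step_act to Fs var_act x j) = T i u j.

Lemma node_coef_act x n j :
  node_coef (program_act x n) (step_act to Fs var_act x j) = node_coef n j.
Proof.
by case: n => [e|[[[|i] i_L] u]] //=; case: j => [u|[[z u]|a]] /=.
Qed.

Lemma node_fac_act x n j k :
  node_fac (program_act x n) (step_act to Fs var_act x j) k =
  omap (node_act (ips_act to Fs x) (program_act x)) (node_fac n j k).
Proof.
case: n => [e|[[[|i] i_L] u]] //=.
  case: j => [u|[[z u]|a]] //=; rewrite low_word_act //.
  case: ifP => // _; rewrite ffunE; case: (u k) => //= z.
  by rewrite var_node_act.
case: j => [u'|[[z u']|a]] //=; case: k => -[|[|k]] //= _.
by rewrite var_node_act.
Qed.

End Symmetry.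

Section Values.
Variables (Z' : finType) (h : (X + 'I_m)%type -> mpol F Z').
Variable v : node -> mpol F Z'.
Hypothesis vP : valuation node_coef node_fac h v.

Definition var_val (z : V) : mpol F Z' := node_val h v (var_node z).

Definition layer (i : nat) (u : W) : mpol F Z' := v (inr (inord i, u)).

Lemma ext_node_val (p : mpol F V) e :
  (forall u, ~~ low_word cls e u -> c e u = 0) ->
  p = \sum_u c e u *: word_val F u -> v (inl e) = msubst var_val p.
Proof.
move=> c0 ->; rewrite vP sum_step /= [X in _ + (X + _)]big1; last first.
  by move=> zu _; rewrite scale0r.
rewrite [X in _ + (_ + X)]big1 ?addr0; last by move=> a _; rewrite scale0r.
rewrite linear_sum; apply: eq_bigr => u _; rewrite linearZ /=.
have [u_low|/c0 ->] := boolP (low_word cls e u); last by rewrite !scale0r.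
congr (_ *: _); rewrite rmorph_prod; apply: eq_bigr => k _.
by case: (u k) => [z|] /=; rewrite ?rmorph1 ?msubst_var.
Qed.

Lemma layer0 u : layer 0 u = 0.
Proof. by rewrite /layer vP big1 // => j _; rewrite /= inordK // scale0r. Qed.

Lemma layerS i u : (i < L)%N ->
  layer i.+1 u =
  \sum_j T i u j *: step_val (fun a => h (inr a)) var_val (layer i) j.
Proof.
move=> i_L; rewrite /layer vP; apply: eq_bigr => j _ /=.
rewrite inordK ?ltnS //; congr (_ *: _).
rewrite 2!big_ord_recl /= big1 ?mulr1; last first.
  by move=> k _; case: j => [u'|[[z u']|a]].
by case: j => [u'|[[z u']|a]] /=; rewrite ?mulr1.
Qed.

End Values.

End RefutationProgram.

(** * The order of the group in the field, and degrees of extension axioms *)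

Lemma natr_card_neq0 (F : fieldType) (gT : finGroupType) :
  ([pchar F] =i pred0 \/
   exists2 q : nat, q \in [pchar F] & coprime #|gT| q) ->
  #|gT|%:R != 0 :> F.
Proof.
have gT_gt0 : (0 < #|gT|)%N by apply/card_gt0P; exists 1%g.
case=> [char0|[q q_char co]].
  by apply/negP => /(natf0_pchar gT_gt0) [p]; rewrite char0.
rewrite -(dvdn_pcharf q_char) -prime_coprime ?(pcharf_prime q_char) //.
by rewrite coprime_sym.
Qed.

(** The polynomial [ext e] is a variable minus its axiom, so its degree is at most the maximum of
    [k] and 1; [k.+2] is the word length in use. *)
Lemma ext_axiom_mdegree (F : fieldType) (X : finType) (r : nat)
    (ext : 'I_r -> mpol F (X + 'I_r)%type) e k :
  (mdegree (ext_axiom ext e) <= k)%N -> (mdegree (ext e) <= k.+2)%N.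
Proof.
rewrite !mdegree_le => l_k.
have -> : ext e = mvar F (inr e) - ext_axiom ext e.
  by rewrite /ext_axiom opprB addrC subrK.
apply: leq_trans (msizeD_le _ _) _; rewrite msizeN geq_max mmeasureX /= mdeg1.
by apply: leq_trans l_k _; rewrite ltnW.
Qed.

(** * The symmetric certificate *)

Section Main.
Variables (F : fieldType) (gT : finGroupType) (X : finType).
Variables (to : {action gT &-> X}) (m : nat) (Fs : m.-tuple (mpol F X)).
Hypotheses (Fs_uniq : uniq Fs) (Fs_inv : invariant_system to Fs).
Hypothesis card_nz : #|gT|%:R != 0 :> F.
Variables (k r : nat) (ext : 'I_r -> mpol F (X + 'I_r)%type).
Variable lines : seq (mpol F (X + 'I_r)%type).
Hypothesis linesP : forall i : nat, (i < size lines)%N ->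
  epc_line ext Fs (take i lines) (nth 0 lines i).
Hypothesis lines_last : last 0 lines = 1.
Hypothesis lines_deg : forall l, l \in lines -> (mdegree l <= k)%N.
Hypothesis ext_lifts : naturally_lifts to ext.

Local Notation V := (X + 'I_r)%type.
Local Notation W := (word V k.+2).
Local Notation L := (size lines).

(** The last line is 1 and is expanded as the empty word alone, so that a single gate of the last
    layer certifies it. *)
Lemma lines_words :
  exists w : nat -> W -> F,
    (forall j, nth 0 lines j = \sum_u w j u *: word_val F u) /\
    forall u, w L.-1 u = (u == empty_word V k.+2)%:R.
Proof.
have /fin_all_exists [w wE] (j : 'I_L) : exists w : W -> F,
    nth 0 lines j = \sum_u w u *: word_val F u.
  apply: word_span; apply: leq_trans (lines_deg (mem_nth 0 (ltn_ord j))) _.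
  by rewrite ltnW.
exists (fun j => if j == L.-1 then fun u => (u == empty_word V k.+2)%:R
                 else if insub j is Some j' then w j' else fun=> 0).
split=> [j|u]; last by rewrite eqxx.
case: eqP => [->|_].
  rewrite nth_last lines_last (bigD1 (empty_word V k.+2)) //= eqxx scale1r.
  by rewrite word_val_empty big1 ?addr0 // => u /negbTE ->; rewrite scale0r.
case: insubP => [j' _ <-|j_L]; first exact: wE.
have L_j : (L <= j)%N by rewrite leqNgt.
by rewrite nth_default // big1 // => u _; rewrite scale0r.
Qed.

(** The output is the gate of the empty word in layer [L]. It is fixed by the group, and its value
    becomes 1 once the y's are replaced by [Fs], since this layer certifies the last line. *)
Lemma symmetric_certificate :
  exists (C : circuit F (X + 'I_m)%type) (P : mpol F (X + 'I_m)%type),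
    [/\ computes C P, ips_certificate Fs P, y_linear P,
        circuit_symmetric (ips_act to Fs) C
      & (#|gate C| <= #|{: X + 'I_m}| + #|node X r k L| +
          (k.+2 + 2) * (#|node X r k L| * #|step X m r k.+2|))%N].
Proof.
have [s [cls [act [ext_cls ext_inj ext_act act_cls]]]] := ext_lifts.
pose var_act x := ext_var_act to x (act x).
have var_actP : is_act var_act.
  exact: var_act_is_act ext_cls ext_inj ext_act act_cls.
have [w [wE w_last]] := lines_words.
have [c [c_act c_low cE]] :=
  low_ext_words ext_cls ext_inj ext_act act_cls k.+2 card_nz.
have [T [T_act TE]] : exists T : nat -> W -> step X m r k.+2 -> F,
    (forall i x u j, T i (word_act var_act x u) (step_act to Fs var_act x j) =
                     T i u j) /\
    forall i, (i < L)%N -> forall th C,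
      (forall x z, th (var_act x z) = mrename (to^~ x) (th z)) ->
      (forall x u, C (word_act var_act x u) = mrename (to^~ x) (C u)) ->
      good_eval ext lines th ->
      (forall j, (j < i)%N -> certifies lines w th C j) ->
      forall j, (j <= i)%N ->
        certifies lines w th
          (fun u => \sum_j T i u j *: step_val (tnth Fs) th C j) j.
  have /fin_all_exists [T TP] (i : 'I_L) :=
    layer_exists Fs_uniq Fs_inv card_nz linesP var_actP wE (ltn_ord i).
  (* Past the last line the coefficients are 0, which is invariant too. *)
  exists (fun i => if insub i is Some i' then T i' else fun _ _ => 0).
  split=> [i x u j|i i_L].
    by case: insubP => // i' _ _; rewrite (TP i').1.
  by rewrite insubT; have := (TP (Ordinal i_L)).2.
pose o : node X r k L := inr (inord L, empty_word V k.+2).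
pose ncoef := node_coef (m := m) (L := L) c T.
pose nfac := node_fac (X := X) (m := m) (d := k) (L := L) cls.
have fac_rk := @node_fac_rank X m r s cls k L.
have [v vP] : exists v, valuation ncoef nfac (mvar F (Z := _)) v.
  exact: (valuation_exists _ fac_rk).
have [C [Cv C_card C_sym]] := program_circuit fac_rk o vP.
exists C, (v o).
pose sg (z : (X + 'I_m)%type) : mpol F X :=
  match z with inl x => mvar F x | inr i => tnth Fs i end.
(* The same program over [X], with [Fs] for the y's: certification and equivariance are proved for
   [v'], linearity for [v]. *)
pose v' n := msubst sg (v n).
have v'P : valuation ncoef nfac sg v'.
  move=> n; have := valuation_msubst sg vP n => /= vn; rewrite {1}/v' vn.
  apply: eq_bigr => j _; congr (_ *: _); apply: eq_bigr => i _.
  by case: (nfac n j i) => [[z|n']|] //=; rewrite msubst_var.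
have step_inj x : injective (step_act (d := k.+2) to Fs var_act x).
  exact: (can_inj (is_actK x (step_act_is_act Fs_uniq Fs_inv var_actP _))).
have v'_act x n : v' (program_act to act x n) = mrename (to^~ x) (v' n).
  apply: (valuation_equivariant fac_rk (actZ := ips_act to Fs x)
    (psi := step_act to Fs var_act x) v'P) => //.
  - by move=> n' j; apply: node_coef_act.
  - by move=> n' j i; apply: node_fac_act.
  - case=> [z|i] /=; first by rewrite mrename_var.
    exact: tnth_axiom_act.
pose th := var_val sg v'.
have th_act x z : th (var_act x z) = mrename (to^~ x) (th z).
  case: z => [z|e]; last exact: (v'_act x (inl e)).
  by rewrite /th /var_val /= mrename_var.
have th_good : good_eval ext lines th.
  split=> // e e_lines; rewrite [RHS](ext_node_val v'P (c_low e) (cE e)).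
  (* An axiom that occurs as a line has small degree, so here [low_ext] agrees with [ext]. *)
  by rewrite /low_ext (ext_axiom_mdegree (lines_deg e_lines)).
have layers i : (i <= L)%N -> forall j, (j < i)%N ->
    certifies lines w th (layer v' i) j.
  elim: i => // i IH i_L j j_i; rewrite /certifies.
  under eq_bigr => u _ do rewrite (layerS v'P u i_L).
  apply: (TE i i_L th (layer v' i) th_act _ th_good (IH (ltnW i_L)) j j_i).
  by move=> x u; apply: (v'_act x (inr (inord i, u))).
have L_gt0 : (0 < L)%N.
  case: lines lines_last => //= /esym/eqP; rewrite oner_eq0 //.
have v'_o : v' o = 1.
  have := layers L (leqnn L) L.-1; rewrite ltn_predL => /(_ L_gt0).
  rewrite /certifies nth_last lines_last rmorph1 => <-.
  rewrite (bigD1 (empty_word V k.+2)) //= w_last eqxx scale1r.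
  by rewrite big1 ?addr0 // => u u0; rewrite w_last (negbTE u0) scale0r.
pose thv := var_val (mvar F (Z := _)) v.
pose sg0 (z : (X + 'I_m)%type) : mpol F X :=
  match z with inl x => mvar F x | inr _ => 0 end.
(* The values of the variables contain no y: they survive setting all y's to 0. Multiplying a layer
   by them therefore preserves linearity. *)
have thvX z : thv z = mrename inl (msubst sg0 (thv z)).
  case: z => [z|e]; first by rewrite /thv /var_val /= msubst_var /= mrename_var.
  have [n] := ubnP (cls e); elim: n e => // n IH e e_n.
  rewrite [thv _](ext_node_val vP (c_low e) (cE e)) -/thv.
  rewrite [msubst sg0 _]msubst_msubst [mrename _ _]msubst_msubst.
  apply: eq_msubst_in => -[z|e'] /=.
    by rewrite /thv /var_val /= msubst_var /= -/(mrename _ _) mrename_var.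
  move=> /(low_ext_cls ext_cls) e'_e; apply: IH.
  exact: leq_trans e'_e e_n.
have lin i u : (i <= L)%N -> y_linear (layer v i u).
  elim: i u => [|i IH] u i_L; first by rewrite (layer0 vP); apply: y_linear0.
  rewrite (layerS vP u i_L); apply: (big_ind (@y_linear F X m)).
  - exact: y_linear0.
  - exact: y_linearD.
  move=> j _; apply: y_linearZ; case: j => [u'|[[z u']|a]] /=.
  - exact/IH/ltnW.
  - by rewrite -/thv thvX; apply/y_linearM/IH/ltnW.
  - exact: y_linear_var.
have o_lin : y_linear (v o) by apply: lin.
split=> //; first by split=> //; apply: y_linear_at0 o_lin.
apply: C_sym => x; exists (program_act to act x), (step_act to Fs var_act x).
split; split=> //.
- case=> [z|i] [z'|i'] //= [].
    by move/act_inj->.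
  by move/(can_inj (is_actK x (axiom_act_is_act Fs_uniq Fs_inv)))->.
- move=> [e|[i u]] [e'|[i' u']] //= [].
    by move/(lift_act_inj act_cls)->.
  move=> -> eu; congr (inr (_, _)); apply: can_inj eu.
  exact: is_actK (word_act_is_act _ var_actP).
- by rewrite /= word_act_empty.
- by move=> n j; apply: node_coef_act.
- by move=> n j i; apply: node_fac_act.
Qed.

End Main.

(** * The polynomial size bound *)

Definition size_bound (d D : nat) : nat :=
  (let nodes := D.+1 + D.+1 * D.+1 ^ d in
   let steps := D.+1 ^ d + (D.+1 * D.+1 ^ d + D.+1) in
   D.+1 + nodes + (d + 2) * (nodes * steps))%N.

Lemma size_bound_poly d :
  exists p : {poly nat}, forall D : nat, p.[D] = size_bound d D.
Proof.
have [S SE] : exists S : {poly nat}, forall D : nat, S.[D] = D.+1.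
  by exists ('X + 1%:P) => D; rewrite hornerD hornerX hornerC -addn1.
have powE (D : nat) : (S ^+ d).[D] = (D.+1 ^ d)%N by rewrite horner_exp SE.
have [N NE] : exists N : {poly nat}, forall D : nat,
    N.[D] = (D.+1 + D.+1 * D.+1 ^ d)%N.
  by exists (S + S * S ^+ d) => D; rewrite hornerD hornerM powE SE.
exists (S + N + (d + 2)%N%:P * (N * (S ^+ d + (S * S ^+ d + S)))) => D.
by rewrite !(hornerD, hornerM) hornerC NE powE SE.
Qed.

(** There are at most [D] variables, and the padding letter makes [D.+1] letters, which bounds the
    number of words by [D.+1 ^ d.+2]; the [L.+1] layers count layer 0. *)
Lemma refutation_size_bound (X : finType) (m r d L : nat) :
  (#|{: X + 'I_m}| + #|node X r d L| +
     (d.+2 + 2) * (#|node X r d L| * #|step X m r d.+2|) <=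
   size_bound d.+2 (L + r + (m + #|X|)))%N.
Proof.
set D := (L + r + _)%N.
have X_D : (#|X| + m <= D)%N by rewrite addnC leq_addl.
have L_D : (L <= D)%N by rewrite /D -addnA leq_addr.
have V_D : (#|X| + r <= D)%N.
  by rewrite addnC /D addnA leq_add2r addnAC leq_addl.
have r_D : (r <= D)%N by apply: leq_trans V_D; apply: leq_addl.
have m_D : (m <= D)%N by apply: leq_trans X_D; apply: leq_addl.
have W_D : (#|{: word (X + 'I_r)%type d.+2}| <= D.+1 ^ d.+2)%N.
  by rewrite card_ffun card_option card_sum !card_ord leq_exp2r.
have node_D : (#|node X r d L| <= D.+1 + D.+1 * D.+1 ^ d.+2)%N.
  rewrite card_sum card_prod !card_ord leq_add ?leq_mul //.
  exact: leqW.
have step_D : (#|step X m r d.+2| <=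
    D.+1 ^ d.+2 + (D.+1 * D.+1 ^ d.+2 + D.+1))%N.
  rewrite !card_sum card_prod card_sum !card_ord !leq_add ?leq_mul //.
    exact: leqW.
  exact: leqW.
rewrite !leq_add ?leq_mul // card_sum card_ord; exact: leqW.
Qed.

Theorem theoremA2 (k : nat) :
  exists p : {poly nat},
  forall (F : fieldType) (gT : finGroupType),
    ([pchar F] =i pred0 \/
     exists2 q : nat, q \in [pchar F] & coprime #|gT| q) ->
  forall (X : finType) (to : {action gT &-> X})
         (m : nat) (Fs : m.-tuple (mpol F X)),
    uniq Fs ->
    invariant_system to Fs ->
    unsatisfiable Fs ->
    (system_degree Fs <= k)%N ->
  forall R : epc_refutation Fs,
    (epc_degree R <= k)%N ->
    epc_symmetric to R ->
  exists (C : circuit F (X + 'I_m)%type) (P : mpol F (X + 'I_m)%type),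
    [/\ computes C P,
        ips_certificate Fs P,
        y_linear P,
        circuit_symmetric (ips_act to Fs) C
      & (ips_size C <= p.[epc_size R])%N].
Proof.
have [p pE] := size_bound_poly k.+2; exists p.
move=> F gT /natr_card_neq0 card_nz X to m Fs Fs_uniq Fs_inv _ _ R R_deg R_sym.
case: R R_deg R_sym => r ext lines hier linesP lines_last.
rewrite /epc_degree /epc_symmetric /= => lines_deg ext_lifts.
have deg l : l \in lines -> (mdegree l <= k)%N.
  by move=> l_lines; move/bigmax_leqP_seq: lines_deg; apply.
have [C [P [CP P_cert P_lin C_sym C_card]]] :=
  symmetric_certificate Fs_uniq Fs_inv card_nz linesP lines_last deg ext_lifts.
exists C, P; split=> //.
rewrite pE; have size_le := refutation_size_bound X m r k (size lines).
rewrite geq_max (leq_trans C_card size_le) /=.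
(* The other entry of the maximum, the number of variables, is already the first summand of the
   bound on the gates. *)
apply: leq_trans size_le; rewrite card_sum card_ord -addnA; exact: leq_addr.
Qed.
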